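(* Suppose that there are constants such that, uniformly for $|\varepsilon|+|a|+\|b\|_{X_1}$ small, $$\|N_2(\varepsilon,a,b)\|_{X_2}\le C(|a|+\|b\|_{X_1})^2,\qquad \|\partial_aN_2\|_{\mathcal L(\mathbb R^n,\mathcal B_2)}+\|\partial_bN_2\|_{\mathcal L(\mathcal B_1,\mathcal B_2)}\le C(|a|+\|b\|_{X_1}),\qquad \|\partial_\varepsilon N_2\|_{\mathcal L(\mathbb R^m,\mathcal B_2)}\le C(|a|+\|b\|_{X_1})^2 .$$ Suppose that, for every $(\varepsilon,a,b)$ in a neighborhood $\mathcal V$ of the origin in $\mathbb R^m\times\mathbb R^n\times X_1$, $\mathrm{Id}-S(\varepsilon,a,b)$ possesses a right inverse $(\mathrm{Id}-S(\varepsilon,a,b))^{-1}:X_2\to\mathcal B_1$ that is bounded in $\mathcal L(\mathcal B_2,\mathcal B_1)$ and $\mathcal L(X_2,X_1)$ norms, that this right inverse is Lipschitz in $b$ as a function from $\mathcal B_1$ to $\mathcal L(\mathcal B_2,\mathcal B_1)$ and Lipschitz in $(\varepsilon,a)$ as a function from $\mathbb R^{m+n}$ to $\mathcal L(X_2,\mathcal B_1)$, with $$\sup_{\mathcal V}\|\partial_b(\mathrm{Id}-S)^{-1}\|_{\mathcal L(\mathcal B_1,\mathcal L(\mathcal B_2,\mathcal B_1))}<\infty,\qquad \sup_{\mathcal V}\|\partial_{\varepsilon,a}(\mathrm{Id}-S)^{-1}\|_{\mathcal L(\mathbb R^m\times\mathbb R^n,\mathcal L(X_2,\mathcal B_1))}<\infty,$$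 and that $$\sup_{\mathcal V}\|(\mathrm{Id}-S)^{-1}\|_{\mathcal L(X_2,X_1)}<\infty,\qquad \sup_{\mathcal V}\|(\mathrm{Id}-S)^{-1}\|_{\mathcal L(\mathcal B_2,\mathcal B_1)}<\infty .$$ For $\omega\in X_1$ set $$\mathcal T(\varepsilon,a,b,\omega):=\omega+(\mathrm{Id}-S(\varepsilon,a,b))^{-1}N_2(\varepsilon,a,b)\in X_1 .$$ Then for $|\varepsilon|+|a|+\|\omega\|_{X_1}$ sufficiently small, $b\mapsto\mathcal T(\varepsilon,a,b,\omega)$ has a unique fixed point $b=B(\varepsilon,a,\omega)\in X_1$ (in a sufficiently small ball of $X_1$ centered at the origin), $B(\varepsilon,0,0)=0$, such that $B$ is Lipschitz in $(\varepsilon,a,\omega)$ with respect to the norm $\|\cdot\|_{\mathcal B_1}$, with $$\|B(\varepsilon,a,\omega)\|_{\mathcal B_1}\le C(\|\omega\|_{\mathcal B_1}+|a|^2),\qquad \|B(\varepsilon,a,\omega)\|_{X_1}\le C(\|\omega\|_{X_1}+|a|^2),$$ and $$\|\partial_\varepsilon B(\varepsilon,a,\omega)\|_{\mathcal L(\mathbb R^m,\mathcal B_1)}\le C(\|\omega\|_{X_1}^2+|a|^2).$$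
   Context: $\mathcal B_1,\mathcal B_2,X_1,X_2$ are Banach spaces with $X_2\hookrightarrow X_1\hookrightarrow\mathcal B_1$ and $X_2\hookrightarrow\mathcal B_2\hookrightarrow\mathcal B_1$, with norms satisfying $\|\cdot\|_{\mathcal B_1}\le\|\cdot\|_{X_1}\le\|\cdot\|_{X_2}$ and $\|\cdot\|_{\mathcal B_1}\le\|\cdot\|_{\mathcal B_2}\le\|\cdot\|_{X_2}$, and such that the unit ball of $X_1$ is closed in $\mathcal B_1$. $\mathcal L(X,Y)$ denotes the bounded linear maps $X\to Y$, and $\mathcal L(X)=\mathcal L(X,X)$. The variables are $(\varepsilon,a,b)\in\mathbb R^m\times\mathbb R^n\times X_1$ (all maps may be defined only in a neighborhood of the origin). $S(\varepsilon,a,b)\in\mathcal L(\mathcal B_1)\cap\mathcal L(X_1)$ is a family of linear operators, and $N_2(\varepsilon,a,b)\in X_2$ is a nonlinear map, continuous in $(\varepsilon,a,b)$ when $b$ is measured in $\mathcal B_1$ and values in $X_2$, with $N_2(\varepsilon,0,0)=0$. A right inverse $(\mathrm{Id}-S)^{-1}:X_2\to\mathcal B_1$ is a linear map with $(\mathrm{Id}-S)(\mathrm{Id}-S)^{-1}x=x$ for $x\in X_2$; its boundedness in $\mathcal L(\mathcal B_2,\mathcal B_1)$ norm means $\|(\mathrm{Id}-S)^{-1}x\|_{\mathcal B_1}\le C\|x\|_{\mathcal B_2}$ for $x\in X_2$. Maps are only assumed Lipschitz; bounds on derivatives $\partial_\varepsilon,\partial_a,\partial_b$ of Lipschitz maps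 are understood as bounds on local Lipschitz constants with respect to the indicated norms. *)

(* Defs.v *)
From HB Require Import structures.
From mathcomp Require Import all_boot all_order all_algebra.
From mathcomp Require Import all_classical all_reals all_analysis.

Set Implicit Arguments.
Unset Strict Implicit.
Unset Printing Implicit Defensive.

Import Order.TTheory GRing.Theory Num.Def Num.Theory.
Import numFieldNormedType.Exports.

Local Open Scope classical_set_scope.
Local Open Scope ring_scope.

(* Inclusions of Banach spaces are injective linear maps of norm at most 1. *)
Definition embedding (R : realType) (V W : normedModType R)
    (i : {linear V -> W}) : Prop :=
  injective i /\ forall x, `|i x| <= `|x|.

(* The norm of W on V, through the inclusion i. *)
Definition inorm (R : realType) (V W : normedModType R)
    (i : {linear V -> W}) (x : V) : R := `|i x|.

(* Best constant M with q (A x) <= M * p x, and +oo if there is none. The norms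
   p and q need not be those of V and W: for A : X2 -> X1, taking the norms of
   B2 and B1 gives the L(B2, B1) norm of A tested on X2. *)
Definition opnorm (R : realType) (V W : lmodType R) (p : V -> R) (q : W -> R)
    (A : V -> W) : \bar R :=
  ereal_inf [set M%:E | M in
    [set M : R | 0 <= M /\ forall x, q (A x) <= M * p x]].

Definition bounded_linear (R : realType) (V W : normedModType R)
    (A : V -> W) : Prop :=
  linear A /\ (opnorm normr normr A < +oo)%E.

(* Local Lipschitz constant of f at x: increments are measured by p and q, but
   the neighborhoods of x are those of U. When f is a partial map of a map of
   several variables, this is the norm of the partial derivative. *)
Definition loclip (R : realType) (U : normedModType R) (W : zmodType)
    (p : U -> R) (q : W -> \bar R) (f : U -> W) (x : U) : \bar R :=
  ereal_inf [set L%:E | L in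
    [set L : R | 0 <= L /\
      \forall y & z \near x, (q (f y - f z)%R <= (L * p (y - z)%R)%:E)%E]].

(* S belongs to L(B1) and restricts to an element of L(X1). *)
Definition bounded_on_both (R : realType) (X1 B1 : normedModType R)
    (i : {linear X1 -> B1}) (S : B1 -> B1) : Prop :=
  bounded_linear S /\
  exists SX : X1 -> X1, bounded_linear SX /\ forall x, i (SX x) = S (i x).

(* Continuity of N2 on D with b measured in B1, through the inclusion i, although
   b ranges over X1. *)
Definition continuous_B1 (R : realType) (m n : nat) (X2 X1 B1 : normedModType R)
    (i : {linear X1 -> B1}) (D : set ('rV[R]_m * 'rV[R]_n * X1))
    (N2 : 'rV[R]_m -> 'rV[R]_n -> X1 -> X2) : Prop :=
  forall e a b, D (e, a, b) -> forall eta : R, 0 < eta ->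
    exists2 theta : R, 0 < theta &
      forall e' a' b', D (e', a', b') ->
        `|e' - e| + `|a' - a| + `|i (b' - b)| < theta ->
        `|N2 e' a' b' - N2 e a b| < eta.

(* Q : X2 -> X1 is a linear right inverse of Id - S. Boundedness in the
   L(X2, X1) norm forces a right inverse X2 -> B1 to take its values in X1, so
   X1 is used as codomain. *)
Definition is_right_inverse (R : realType) (X2 X1 B1 : normedModType R)
    (j : {linear X2 -> X1}) (i : {linear X1 -> B1}) (S : B1 -> B1)
    (Q : X2 -> X1) : Prop :=
  linear Q /\ forall x, i (Q x) - S (i (Q x)) = i (j x).

Definition calT (R : realType) (m n : nat) (X2 X1 : normedModType R)
    (Q : 'rV[R]_m -> 'rV[R]_n -> X1 -> X2 -> X1)
    (N2 : 'rV[R]_m -> 'rV[R]_n -> X1 -> X2)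
    (e : 'rV[R]_m) (a : 'rV[R]_n) (b w : X1) : X1 :=
  w + Q e a b (N2 e a b).

(* Main.v *)
Require Import Defs.
From HB Require Import structures.
From mathcomp Require Import all_boot all_order all_algebra.
From mathcomp Require Import all_classical all_reals all_analysis.
From mathcomp Require Import ring lra.

Set Implicit Arguments.
Unset Strict Implicit.
Unset Printing Implicit Defensive.

Import Order.TTheory GRing.Theory Num.Def Num.Theory.
Import numFieldNormedType.Exports.

Local Open Scope classical_set_scope.
Local Open Scope ring_scope.

(** The fixed point is Banach's, applied to b |-> T(e, a, b, w) on a small ball
    of X1 but with the metric of B1. The two norms play different roles:

    - Q is bounded from X2 to X1 and N2 is quadratic in the norm of X2, so T
      maps the ball of radius r of X1 to itself when a and w are small;
    - derivatives lose regularity: T is a contraction only for the norm of B1,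
      with constant O(r). As the balls of X1 are closed in B1, they are complete
      for this weaker metric, and the fixed point still belongs to X1.

    Everything quantitative comes from one estimate, [T_lipschitz]: if s bounds
    |a| + |b| along the way and K is a common bound for all the constants of the
    hypotheses, then increments of T in the norm of B1 are at most

      |w - w'| + 2 K^2 (s^2 |e - e'| + s |a - a'| + s |b - b'|).

    The splitting behind it is
    Q(v) N(v) - Q(v') N(v') = Q(v) (N(v) - N(v')) + (Q(v) - Q(v')) N(v'). In the
    first term only the L(B2, B1) norm of Q(v) and the B2 norm of the increment
    of N are needed; in the second one, N(v') is quadratic in X2, which pays for
    the variation of Q in e and a, available only from X2 to B1. With s of order
    r the factor of |b - b'| is at most 1/2: this is the contraction, and, after
    absorption, the Lipschitz dependence of the fixed point. With s of the order
    of the actual size |a| + |w| of the data, the factor s^2 of |e - e'| is the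
    bound on the derivative in e. The size estimates of the fixed point itself
    absorb the b-dependence of T in the same way.

    The hypotheses speak of local Lipschitz constants at points. They turn into
    Lipschitz estimates on convex sets by [loclip_segment]: a local Lipschitz
    constant bounded by L along a segment gives the Lipschitz constant L between
    its endpoints. *)

(** * Lipschitz bounds from local Lipschitz constants *)

Lemma near2_ball (R : realType) (U : normedModType R) (x : U)
    (P : U -> U -> Prop) : (\forall y & z \near x, P y z) ->
  exists2 d : R, 0 < d & forall y z, `|y - x| < d -> `|z - x| < d -> P y z.
Proof.
case=> -[A B] /= [/nbhs_normP[d d0 Ad] /nbhs_normP[d' d'0 Bd]] AB.
exists (minr d d'); first by rewrite lt_min; apply/andP.
move=> y z; rewrite !lt_min => /andP[yd _] /andP[_ zd].
by apply: (AB (y, z)); split; [apply: Ad|apply: Bd]; rewrite /ball_ /= distrC.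
Qed.

(** The infimum in [loclip] need not be attained, whence the loss of eta. *)
Lemma loclip_near (R : realType) (U : normedModType R) (W : zmodType)
    (p : U -> R) (q : W -> \bar R) (f : U -> W) (x : U) (L eta : R) :
  (forall u, 0 <= p u) -> 0 < eta -> (loclip p q f x <= L%:E)%E ->
  \forall y & z \near x, (q (f y - f z)%R <= ((L + eta) * p (y - z)%R)%:E)%E.
Proof.
move=> p0 eta0 fL.
have : (loclip p q f x < (L + eta)%:E)%E.
  by apply: le_lt_trans fL _; rewrite lte_fin ltrDl.
move=> /ereal_inf_lt[_ [M [M0 fM] <-]]; rewrite lte_fin => ML.
apply: filterS fM => -[y z] /= /le_trans; apply.
by rewrite lee_fin ler_wpM2r// ltW.
Qed.

Lemma loclip_le (R : realType) (U : normedModType R) (W : zmodType)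
    (p : U -> R) (q : W -> \bar R) (f : U -> W) (x : U) (d L : R) :
  0 < d -> 0 <= L ->
  (forall y z, `|y - x| < d -> `|z - x| < d ->
     (q (f y - f z)%R <= (L * p (y - z)%R)%:E)%E) ->
  (loclip p q f x <= L%:E)%E.
Proof.
move=> d0 L0 fL; apply: ereal_inf_lbound; exists L => //; split => //.
have xd : \forall y \near x, `|y - x| < d.
  by apply/nbhs_normP; exists d => //= y; rewrite /ball_ /= distrC.
exists ([set y | `|y - x| < d], [set y | `|y - x| < d]) => //=.
by move=> [y z] /= [yd zd]; exact: fL.
Qed.

Lemma loclip_ge0 (R : realType) (U : normedModType R) (W : zmodType)
    (p : U -> R) (q : W -> \bar R) (f : U -> W) (x : U) :
  (0 <= loclip p q f x)%E.
Proof. by apply: le_ereal_inf_tmp => _ [L [L0 _] <-]; rewrite lee_fin. Qed.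

(** A continuity argument along [0, 1]. The times t with
    |g t - g 0| <= K t have a supremum c, and one of them, t0, is so close to c
    that g is K-Lipschitz between t0 and points slightly beyond c. Hence these
    points are such times too, unless c = 1. *)
Lemma lipschitz_of_locally (R : realType) (Z : normedModType R) (g : R -> Z)
    (K : R) :
  (forall t, 0 <= t <= 1 -> exists2 d, 0 < d & forall s s',
    `|s - t| < d -> `|s' - t| < d -> `|g s - g s'| <= K * `|s - s'|) ->
  `|g 1 - g 0| <= K.
Proof.
move=> gK.
pose E := [set t | 0 <= t <= 1 /\ `|g t - g 0| <= K * t].
have E0 : E 0 by split; rewrite ?lexx ?ler01// subrr normr0 mulr0.
have supE : has_sup E by split; [exists 0|exists 1 => t [/andP[]]].
have c0 : 0 <= sup E by exact: sup_upper_bound.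
have c1 : sup E <= 1 by apply: ge_sup; [exists 0|move=> t [/andP[]]].
have [|d d0 gd] := gK (sup E); first by rewrite c0.
have [t0 [/andP[t00 t01] gt0] ct0] := sup_adherent d0 supE.
have t0c : t0 <= sup E by apply: sup_upper_bound => //; rewrite /E /= t00.
(* the supremum is attained and equals 1, because s belongs to E *)
pose s := minr (sup E + d / 2) 1.
have sE : s <= sup E + d / 2 by rewrite /s ge_min lexx.
have s1 : s <= 1 by rewrite /s ge_min lexx orbT.
have t0s : t0 <= s by rewrite /s le_min t01 andbT; lra.
have cs : sup E <= s by rewrite /s le_min c1 andbT; lra.
have Es : E s.
  split; first by rewrite s1 andbT; lra.
  have -> : g s - g 0 = (g s - g t0) + (g t0 - g 0) by rewrite addrA subrK.
  apply: le_trans (ler_normD _ _) _.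
  have : `|g s - g t0| <= K * `|s - t0| by apply: gd; rewrite ltr_norml; lra.
  rewrite ger0_norm; last by lra.
  by move: gt0; lra.
have sc : s <= sup E by exact: sup_upper_bound.
have s_eq1 : s = 1.
  by move: (sc); rewrite {1}/s ge_min => /orP[|] ?; lra.
by case: Es => _; rewrite s_eq1 mulr1.
Qed.

(** From local to global Lipschitz bounds, for the two kinds of target that
    occur. The increments are measured through an additive map phi to a normed
    space, controlled by q up to the factor kappa: when q is the norm of B2 on
    X2, phi is the inclusion and kappa = 1; when q is an operator norm, phi is
    the evaluation at a vector x and kappa is the norm of x. This reduces
    operator valued maps to vector valued ones, so that subadditivity of the
    extended real valued q never comes up. *)
Lemma loclip_segment (R : realType) (U Z : normedModType R) (W : zmodType)
    (p : U -> R) (q : W -> \bar R) (phi : W -> Z) (kappa : R)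
    (f : U -> W) (L : R) (x y : U) :
  (forall u, 0 <= p u) -> (forall t u, p (t *: u) = `|t| * p u) ->
  (forall v w, phi (v - w) = phi v - phi w) ->
  0 <= kappa -> (forall w c, (q w <= c%:E)%E -> `|phi w| <= c * kappa) ->
  (forall t, 0 <= t <= 1 -> (loclip p q f (x + t *: (y - x))%R <= L%:E)%E) ->
  `|phi (f y - f x)| <= L * p (y - x) * kappa.
Proof.
move=> p0 pZ phiB kappa0 qphi fL; apply/ler_addgt0Pr => /= eps eps0.
(* an excess eta in the local constants costs at most eps in the end *)
pose eta := eps / (p (y - x) * kappa + 1).
have pk0 : 0 <= p (y - x) * kappa by exact: mulr_ge0.
have eta0 : 0 < eta by rewrite divr_gt0// ltr_wpDl.
have : (L + eta) * p (y - x) * kappa <= L * p (y - x) * kappa + eps.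
  rewrite -mulrA mulrDl mulrA lerD2l /eta -mulrA ger_pMr//.
  by rewrite mulrC ler_pdivrMr ?mul1r ?lerDl ?ltr_wpDl.
apply: le_trans.
pose g t := phi (f (x + t *: (y - x))).
have -> : phi (f y - f x) = g 1 - g 0.
  by rewrite phiB /g scale1r scale0r addr0 subrKC.
apply: lipschitz_of_locally => t t01.
have [d d0 fd] := near2_ball (loclip_near p0 eta0 (fL t t01)).
exists (d / (`|y - x| + 1)); first by rewrite divr_gt0// ltr_wpDl.
have near_t s : `|s - t| < d / (`|y - x| + 1) ->
    `|x + s *: (y - x) - (x + t *: (y - x))| < d.
  rewrite opprD addrACA subrr add0r -scalerBl normrZ ltr_pdivlMr ?ltr_wpDl//.
  by apply: le_lt_trans; rewrite ler_wpM2l// lerDl.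
move=> s s' /near_t hs /near_t hs'.
move: (qphi _ _ (fd _ _ hs hs')); rewrite -phiB.
rewrite opprD addrACA subrr add0r -scalerBl pZ.
by move=> /le_trans; apply; rewrite le_eqVlt; apply/orP; left; apply/eqP; ring.
Qed.

(** * Operator norms and segments *)

(** The best constant is itself admissible, by a limit. *)
Lemma opnorm_le (R : realType) (V W : lmodType R) (p : V -> R) (q : W -> R)
    (A : V -> W) (M : R) (x : V) :
  0 <= p x -> (opnorm p q A <= M%:E)%E -> q (A x) <= M * p x.
Proof.
move=> px0 AM; apply/ler_addgt0Pr => /= eps eps0.
have eta0 : 0 < eps / (p x + 1) by rewrite divr_gt0// ltr_wpDl.
have : (opnorm p q A < (M + eps / (p x + 1))%:E)%E.
  by apply: le_lt_trans AM _; rewrite lte_fin ltrDl.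
move=> /ereal_inf_lt[_ [M' [_ AM'] <-]]; rewrite lte_fin => MM'.
apply: le_trans (AM' x) _.
apply: le_trans (ler_wpM2r px0 (ltW MM')) _.
rewrite mulrDl lerD2l -mulrA ger_pMr// mulrC ler_pdivrMr ?ltr_wpDl//.
by rewrite mul1r lerDl.
Qed.

Lemma ereal_sup_bounded (R : realType) (S : set (\bar R)) :
  (ereal_sup S < +oo)%E ->
  exists2 M : R, 0 <= M & forall x, S x -> (x <= M%:E)%E.
Proof.
move=> S_fin; exists (Num.max 0 (fine (ereal_sup S))).
  by rewrite le_max lexx.
move=> x Sx; have := ereal_sup_ubound Sx.
case: (ereal_sup S) S_fin => [M _|//|_] xM /=; apply: le_trans xM _.
  by rewrite lee_fin le_max lexx orbT.
exact: leNye.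
Qed.

Lemma norm_segment_le (R : realType) (U : normedModType R) (x y : U) (c t : R) :
  0 <= t <= 1 -> `|x| <= c -> `|y| <= c -> `|x + t *: (y - x)| <= c.
Proof.
move=> /andP[t0 t1] xc yc.
have -> : x + t *: (y - x) = (1 - t) *: x + t *: y.
  by rewrite scalerBr scalerBl scale1r addrAC addrA.
apply: le_trans (ler_normD _ _) _; rewrite !normrZ !ger0_norm ?subr_ge0//.
have t1' : 0 <= 1 - t by rewrite subr_ge0.
by have := ler_wpM2l t0 yc; have := ler_wpM2l t1' xc; lra.
Qed.

Lemma norm_segment_lt (R : realType) (U : normedModType R) (x y : U) (c t : R) :
  0 <= t <= 1 -> `|x| < c -> `|y| < c -> `|x + t *: (y - x)| < c.
Proof.
move=> t01 xc yc; have : maxr `|x| `|y| < c by rewrite gt_max xc.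
by apply: le_lt_trans; apply: norm_segment_le; rewrite ?le_max ?lexx ?orbT.
Qed.

(** * The fixed point problem *)

Section FixedPoint.
Context {R : realType} {E A : normedModType R}.
Context {X1 X2 B2 : normedModType R} {B1 : completeNormedModType R}.
Variables (i : {linear X1 -> B1}) (j : {linear X2 -> B2}).
Hypotheses (i_inj : injective i) (i_le : forall x, `|i x| <= `|x|).
Hypothesis j_le : forall x, `|j x| <= `|x|.
Hypothesis ball_closed : closed (i @` [set b : X1 | `|b| <= 1]).
Variables (N : E -> A -> X1 -> X2) (Q : E -> A -> X1 -> X2 -> X1) (K rho : R).
Hypothesis K_ge0 : 0 <= K.

(** A product of balls, because [T_lipschitz] goes from one triple to another
    through triples that mix entries of both. *)
Let box (e : E) (a : A) (b : X1) := [&& `|e| < rho, `|a| < rho & `|b| < rho].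

Hypothesis QB : forall e a b, box e a b ->
  forall x y, Q e a b (x - y) = Q e a b x - Q e a b y.
Hypothesis Q_X1 : forall e a b, box e a b -> forall x, `|Q e a b x| <= K * `|x|.
Hypothesis Q_B1 : forall e a b, box e a b ->
  forall x, `|i (Q e a b x)| <= K * `|j x|.
Hypothesis Q_lipb : forall e a b b', box e a b -> box e a b' ->
  forall x, `|i (Q e a b x - Q e a b' x)| <= K * `|i (b - b')| * `|j x|.
Hypothesis Q_lipea : forall e a e' a' b, box e a b -> box e' a' b ->
  forall x, `|i (Q e a b x - Q e' a' b x)|
    <= K * (`|e - e'| + `|a - a'|) * `|x|.
Hypothesis N_quad : forall e a b, box e a b ->
  `|N e a b| <= K * (`|a| + `|b|) ^+ 2.
Hypothesis N_lipe : forall e e' a b, box e a b -> box e' a b ->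
  `|j (N e a b - N e' a b)| <= K * (`|a| + `|b|) ^+ 2 * `|e - e'|.
(** The bounds on the derivatives of N in a and b grow along segments, so their
    integrated form needs a common bound s for |a| + |b| at both endpoints. *)
Hypothesis N_lipa : forall e a a' b s, box e a b -> box e a' b ->
  `|a| + `|b| <= s -> `|a'| + `|b| <= s ->
  `|j (N e a b - N e a' b)| <= K * s * `|a - a'|.
Hypothesis N_lipb : forall e a b b' s, box e a b -> box e a b' ->
  `|a| + `|b| <= s -> `|a| + `|b'| <= s ->
  `|j (N e a b - N e a b')| <= K * s * `|i (b - b')|.

Let T e a b w := w + Q e a b (N e a b).

(** The path goes from (e, a, b) to (e', a', b') by changing e, then a, then b;
    s bounds |a| + |b| at each of the corners. Terms that come from the
    variation of Q carry s^2, and s <= 1 merges them with those that carry s. *)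
Lemma T_lipschitz e a b w e' a' b' w' s : box e a b -> box e' a' b' ->
  `|a| + `|b| <= s -> `|a'| + `|b| <= s -> `|a'| + `|b'| <= s -> s <= 1 ->
  `|i (T e a b w - T e' a' b' w')| <= `|i (w - w')| +
    2 * K ^+ 2 * (s ^+ 2 * `|e - e'| + s * `|a - a'| + s * `|i (b - b')|).
Proof.
move=> v0 v3 s0 s2 s3 s1.
have /and3P[e_rho a_rho b_rho] := v0; have /and3P[e'_rho a'_rho b'_rho] := v3.
have v1 : box e' a b by apply/and3P.
have v2 : box e' a' b by apply/and3P.
have sge0 : 0 <= s by apply: le_trans s0; exact: addr_ge0.
have s2s : s ^+ 2 <= s by rewrite expr2 ler_piMr.
set dE := `|e - e'|; set dA := `|a - a'|; set dB := `|i (b - b')|.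
have [dE0 dA0 dB0] : [/\ 0 <= dE, 0 <= dA & 0 <= dB] by split; exact: normr_ge0.
pose n := N e a b; pose n' := N e' a' b'.
have n_n' : `|j (n - n')| <= K * (s ^+ 2 * dE + s * dA + s * dB).
  have -> : n - n' = (n - N e' a b) + (N e' a b - N e' a' b)
      + (N e' a' b - n') by rewrite [n - _ + (_ - _)]addrA subrK addrA subrK.
  rewrite 2!linearD.
  apply: le_trans (ler_normD _ _) _.
  apply: le_trans (lerD (ler_normD _ _) (N_lipb v2 v3 s2 s3)) _.
  apply: le_trans (lerD (lerD (N_lipe v0 v1) (N_lipa v1 v2 s0 s2)) (lexx _)) _.
  rewrite !mulrDr !mulrA !lerD2r -!mulrA.
  apply: ler_wpM2l => //; rewrite !mulrA; apply: ler_wpM2r => //.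
  by rewrite -!expr2 ler_sqr ?nnegrE ?addr_ge0.
have n'_le : `|n'| <= K * s ^+ 2.
  apply: le_trans (N_quad v3) _.
  by apply: ler_wpM2l => //; rewrite ler_sqr ?nnegrE ?addr_ge0.
(* Q(v) n - Q(v') n' = Q(v) (n - n') + (Q(v) - Q(v')) n', through (e', a', b) *)
have -> : T e a b w - T e' a' b' w' = (w - w') + (Q e a b (n - n') +
    ((Q e a b n' - Q e' a' b n') + (Q e' a' b n' - Q e' a' b' n'))).
  rewrite (QB v0) [_ + (_ - Q e' a' b' n')]addrA subrK.
  by rewrite [_ + (_ - Q e' a' b' n')]addrA subrK addrACA -opprD.
rewrite linearD [i (Q e a b _ + _)]linearD [i (_ - _ + _)]linearD.
apply: le_trans (ler_normD _ _) _; rewrite lerD2l.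
apply: le_trans (ler_normD _ _) _.
apply: le_trans (lerD (Q_B1 v0 _) (ler_normD _ _)) _.
apply: le_trans (lerD (lexx _) (lerD (Q_lipea v0 v2 _) (Q_lipb v2 v3 _))) _.
have q1 := ler_wpM2l K_ge0 n_n'.
have q2 : K * (dE + dA) * `|n'| <= K * (dE + dA) * (K * s ^+ 2).
  by apply: ler_wpM2l => //; rewrite mulr_ge0// addr_ge0.
have q3 : K * dB * `|j n'| <= K * dB * (K * s ^+ 2).
  by apply: ler_wpM2l; [exact: mulr_ge0|exact: le_trans (j_le _) _].
apply: le_trans (lerD q1 (lerD q2 q3)) _.
have K2 : 0 <= K ^+ 2 by rewrite sqr_ge0.
have hA : K ^+ 2 * s ^+ 2 * dA <= K ^+ 2 * s * dA.
  by rewrite ler_wpM2r// ler_wpM2l.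
have hB : K ^+ 2 * s ^+ 2 * dB <= K ^+ 2 * s * dB.
  by rewrite ler_wpM2r// ler_wpM2l.
by lra.
Qed.

(** On the ball of radius r one may take s = 2 r in [T_lipschitz]; then
    2 K^2 s <= 1/2 is the condition [r_K]. *)
Variable r : R.
Hypotheses (r_gt0 : 0 < r) (r_rho : r < rho) (r_half : 2 * r <= 1).
Hypothesis r_K : 8 * K ^+ 2 * r <= 1.

Let box_r e a b : `|e| <= r -> `|a| <= r -> `|b| <= r -> box e a b.
Proof. by move=> er ar br; apply/and3P; split; exact: le_lt_trans r_rho. Qed.

Lemma T_contraction e a b b' w : `|e| <= r -> `|a| <= r ->
  `|b| <= r -> `|b'| <= r ->
  `|i (T e a b w - T e a b' w)| <= 2^-1 * `|i (b - b')|.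
Proof.
move=> er ar br b'r.
have v := box_r er ar br; have v' := box_r er ar b'r.
have ab : `|a| + `|b| <= 2 * r by lra.
have ab' : `|a| + `|b'| <= 2 * r by lra.
apply: le_trans (T_lipschitz w w v v' ab ab ab' r_half) _.
rewrite !subrr !(linear0, normr0, mulr0, add0r).
have := ler_wpM2r (normr_ge0 (i (b - b'))) r_K.
by lra.
Qed.

(** The quadratic term in b is linear with a small factor: |b|^2 <= r |b|. *)
Lemma T_bound e a b w : `|e| <= r -> `|a| <= r -> `|b| <= r ->
  `|T e a b w| <= `|w| + 2 * K ^+ 2 * `|a| ^+ 2 + 4^-1 * `|b|.
Proof.
move=> er ar br; have v := box_r er ar br.
apply: le_trans (ler_normD _ _) _; rewrite -addrA lerD2l.
apply: le_trans (Q_X1 v _) _.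
apply: le_trans (ler_wpM2l K_ge0 (N_quad v)) _.
have := sqr_ge0 (`|a| - `|b|).
have : `|b| ^+ 2 <= r * `|b| by rewrite expr2 ler_wpM2r.
have := ler_wpM2r (normr_ge0 b) r_K.
have : 0 <= K ^+ 2 by rewrite sqr_ge0.
set x := `|a|; set y := `|b|; set k := K ^+ 2 => k0 kr yr xy.
have h1 := ler_wpM2l k0 yr; have h2 := mulr_ge0 k0 xy.
have -> : K * (K * (x + y) ^+ 2) = k * (x + y) ^+ 2 by rewrite /k; ring.
by lra.
Qed.

Lemma T_stable e a b w : `|e| <= r -> `|a| <= r -> `|b| <= r ->
  `|w| <= r / 2 -> `|T e a b w| <= r.
Proof.
move=> er ar br wr; apply: le_trans (T_bound w er ar br) _.
have : `|a| ^+ 2 <= r ^+ 2 by rewrite ler_sqr ?nnegrE// ltW.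
move=> /(ler_wpM2l (sqr_ge0 K)).
have := ler_wpM2r (ltW r_gt0) r_K.
by lra.
Qed.

Let ball_r := i @` [set b : X1 | `|b| <= r].

Lemma closed_ball_r : closed ball_r.
Proof.
have -> : ball_r = ( *:%R r^-1) @^-1` (i @` [set b : X1 | `|b| <= 1]).
  apply/seteqP; split => [_ [b /= br <-]|y [b /= b1 by_]].
    exists (r^-1 *: b); last by rewrite linearZ.
    rewrite /= normrZ gtr0_norm ?invr_gt0// mulrC ler_pdivrMr//.
    by rewrite mul1r.
  exists (r *: b); last by rewrite linearZ/= by_ scalerA divff ?scale1r ?gt_eqF.
  by rewrite /= normrZ gtr0_norm// ger_pMr.
by apply: (continuous_closedP _).1 ball_closed; exact: scaler_continuous.
Qed.

(** Banach's theorem in B1, on the closed image of the ball of X1. The map is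
    transported to this image by a section inv of the inclusion. *)
Lemma fixed_point_exists e a w : `|e| <= r -> `|a| <= r -> `|w| <= r / 2 ->
  exists2 b, `|b| <= r & T e a b w = b.
Proof.
move=> er ar wr.
pose inv y := xget 0 [set b : X1 | `|b| <= r /\ i b = y].
have invP y : ball_r y -> `|inv y| <= r /\ i (inv y) = y.
  move=> [b br iby]; rewrite /inv.
  by case: xgetP => [c _ //|/(_ b)] /= /not_andP[].
pose f y := i (T e a (inv y) w).
have fun_f : {homo f : y / ball_r y}.
  by move=> y /invP[yr _]; exists (T e a (inv y) w) => //; exact: T_stable.
have half : 0 <= 2^-1 :> R by rewrite invr_ge0.
have [||_ [c cr <-] /= fc] := @banach_fixed_point _ _ _ (mkfun_fun fun_f)
    _ closed_ball_r _.
- exists (NngNum half); split => /=; first by lra.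
  move=> [y y'] [/= /invP[yr yK] /invP[y'r y'K]].
  rewrite /mkfun /f -linearB.
  apply: le_trans (T_contraction _ _ _ _ _) _ => //.
  by rewrite linearB/= yK y'K.
- by exists (i 0); exists 0 => //=; rewrite normr0 ltW.
exists c => //; have [_ ] := invP (i c) (imageP _ cr).
by move=> /i_inj invc; apply: i_inj; rewrite [RHS]fc /= /mkfun /f invc.
Qed.

Lemma fixed_point_X1_bound e a b w : `|e| <= r -> `|a| <= r -> `|b| <= r ->
  T e a b w = b -> `|b| <= 2 * `|w| + 4 * K ^+ 2 * `|a| ^+ 2.
Proof.
move=> er ar br Tb; have := T_bound w er ar br; rewrite Tb.
have := normr_ge0 w; have := mulr_ge0 (sqr_ge0 K) (sqr_ge0 `|a|).
by lra.
Qed.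

(** Comparing T at b and at 0 gives |b| <= |T(0)| + |b|/2 in B1, and T(0) is w
    up to a term quadratic in a alone. *)
Lemma fixed_point_B1_bound e a b w : `|e| <= r -> `|a| <= r -> `|b| <= r ->
  T e a b w = b -> `|i b| <= 2 * `|i w| + 2 * K ^+ 2 * `|a| ^+ 2.
Proof.
move=> er ar br Tb.
have r0 : `|0 : X1| <= r by rewrite normr0 ltW.
have v0 := box_r er ar r0.
have := T_contraction w er ar br r0; rewrite Tb subr0.
have : `|i (Q e a 0 (N e a 0))| <= K ^+ 2 * `|a| ^+ 2.
  apply: le_trans (i_le _) _; apply: le_trans (Q_X1 v0 _) _.
  apply: le_trans (ler_wpM2l K_ge0 (N_quad v0)) _.
  by rewrite normr0 addr0 mulrA -expr2.
have := ler_normD (i (b - T e a 0 w)) (i (T e a 0 w)).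
rewrite -linearD subrK /T [i (w + _)]linearD.
have := ler_normD (i w) (i (Q e a 0 (N e a 0))).
by lra.
Qed.

(** The term in |b - b'| of [T_lipschitz] is absorbed. The bound s is kept free:
    s = 2 r gives the Lipschitz continuity of B, and a bound by the size of
    a and w gives the estimate on its derivative in e. *)
Lemma fixed_point_lipschitz e a b w e' a' b' w' s :
  `|e| <= r -> `|a| <= r -> `|b| <= r ->
  `|e'| <= r -> `|a'| <= r -> `|b'| <= r ->
  `|a| + `|b| <= s -> `|a'| + `|b| <= s -> `|a'| + `|b'| <= s -> s <= 2 * r ->
  T e a b w = b -> T e' a' b' w' = b' ->
  `|i (b - b')| <= 2 * `|i (w - w')| +
    4 * K ^+ 2 * (s ^+ 2 * `|e - e'| + s * `|a - a'|).
Proof.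
move=> er ar br e'r a'r b'r s0 s2 s3 sr Tb Tb'.
have := T_lipschitz w w' (box_r er ar br) (box_r e'r a'r b'r) s0 s2 s3
  (le_trans sr r_half).
rewrite Tb Tb'.
have sB : s * `|i (b - b')| <= 2 * r * `|i (b - b')| by exact: ler_wpM2r.
have := ler_wpM2l (sqr_ge0 K) sB.
have := ler_wpM2r (normr_ge0 (i (b - b'))) r_K.
by lra.
Qed.

Lemma fixed_point_unique e a b b' w : `|e| <= r -> `|a| <= r ->
  `|b| <= r -> `|b'| <= r -> T e a b w = b -> T e a b' w = b' -> b = b'.
Proof.
move=> er ar br b'r Tb Tb'; apply: i_inj; apply/subr0_eq/eqP.
rewrite -normr_le0 -linearB.
by have := T_contraction w er ar br b'r; rewrite Tb Tb'; lra.
Qed.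

Lemma fixed_point_map : exists (C : R) (B : E -> A -> X1 -> X1),
  [/\ forall e a w, `|e| + `|a| + `|w| < r / 2 ->
        [/\ `|B e a w| <= r /\ T e a (B e a w) w = B e a w,
            forall b, `|b| <= r -> T e a b w = b -> b = B e a w,
            `|i (B e a w)| <= C * (`|i w| + `|a| ^+ 2),
            `|B e a w| <= C * (`|w| + `|a| ^+ 2) &
            (loclip normr (EFin \o inorm i) (fun e' => B e' a w) e
             <= (C * (`|w| ^+ 2 + `|a| ^+ 2))%:E)%E],
      forall e, `|e| < r / 2 -> B e 0 0 = 0 &
      forall e a w e' a' w',
        `|e| + `|a| + `|w| < r / 2 -> `|e'| + `|a'| + `|w'| < r / 2 ->
        `|i (B e a w - B e' a' w')|
          <= C * (`|e - e'| + `|a - a'| + `|i (w - w')|)].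
Proof.
pose B e a w := xget 0 [set b | `|b| <= r /\ T e a b w = b].
have r0 := r_gt0; have r1 := r_half.
pose k := K ^+ 2.
pose k3 := 8 * k * (2 + 4 * k) ^+ 2.
have k0 : 0 <= k by exact: sqr_ge0.
have k30 : 0 <= k3 by rewrite mulr_ge0 ?sqr_ge0//; lra.
pose C := 2 + 4 * k + k3.
have small (e : E) (a : A) (w : X1) : `|e| + `|a| + `|w| < r / 2 ->
    [/\ `|e| <= r, `|a| <= r & `|w| <= r / 2].
  by have := normr_ge0 e; have := normr_ge0 a; have := normr_ge0 w; split; lra.
have BP e a w : `|e| + `|a| + `|w| < r / 2 ->
    `|B e a w| <= r /\ T e a (B e a w) w = B e a w.
  move=> /small[er ar wr]; have [b br Tb] := fixed_point_exists er ar wr.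
  by rewrite /B; case: xgetP => [c _ //|/(_ b)] /= /not_andP[].
have BX e a w : `|e| + `|a| + `|w| < r / 2 ->
    `|B e a w| <= 2 * `|w| + 4 * k * `|a| ^+ 2.
  move=> ds; have [er ar _] := small _ _ _ ds; have [br Tb] := BP _ _ _ ds.
  exact: fixed_point_X1_bound Tb.
exists C, B; split=> [e a w ds|e er|e a w e' a' w' ds ds'].
- have [er ar wr] := small _ _ _ ds; have [br Tb] := BP _ _ _ ds.
  have aw0 := normr_ge0 w; have iw0 := normr_ge0 (i w).
  have a20 := sqr_ge0 `|a|; have w20 := sqr_ge0 `|w|.
  have := mulr_ge0 k0 a20; have := mulr_ge0 k0 aw0; have := mulr_ge0 k0 iw0.
  have := mulr_ge0 k30 a20; have := mulr_ge0 k30 aw0; have := mulr_ge0 k30 iw0.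
  have := mulr_ge0 k0 w20; move=> ? ? ? ? ? ? ?.
  split=> //.
  + by move=> b b_r Tb'; exact: fixed_point_unique Tb' Tb.
  + apply: le_trans (fixed_point_B1_bound er ar br Tb) _.
    by rewrite -/k /C; lra.
  + by apply: le_trans (BX _ _ _ ds) _; rewrite /C; lra.
  pose d := r / 2 - (`|e| + `|a| + `|w|).
  have near_e y : `|y - e| < d -> `|y| + `|a| + `|w| < r / 2.
    by rewrite /d; have := ler_normD (y - e) e; rewrite subrK; lra.
  apply: (@loclip_le _ _ _ _ _ _ _ d); first by rewrite /d; lra.
    by rewrite mulr_ge0 ?addr_ge0//; rewrite /C; lra.
  move=> y z /near_e dy /near_e dz; rewrite /= /inorm lee_fin.
  have [yr _ _] := small _ _ _ dy; have [zr _ _] := small _ _ _ dz.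
  have [Byr TBy] := BP _ _ _ dy; have [Bzr TBz] := BP _ _ _ dz.
  pose s := `|a| + maxr `|B y a w| `|B z a w|.
  have ys : `|a| + `|B y a w| <= s by rewrite lerD2l le_max lexx.
  have zs : `|a| + `|B z a w| <= s by rewrite lerD2l le_max lexx orbT.
  have s0 : 0 <= s by apply: le_trans ys; rewrite addr_ge0.
  have sr : s <= 2 * r.
    have : maxr `|B y a w| `|B z a w| <= r by rewrite ge_max Byr.
    by rewrite /s; lra.
  apply: le_trans
    (fixed_point_lipschitz yr ar Byr zr ar Bzr ys ys zs sr TBy TBz) _.
  rewrite !subrr linear0 !normr0 !mulr0 add0r addr0 mulrA.
  apply: ler_wpM2r => //.
  (* s is of the size of the data, and (|w| + |a|)^2 <= 2 (|w|^2 + |a|^2) *)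
  have s_aw : s <= (2 + 4 * k) * (`|w| + `|a|).
    have : maxr `|B y a w| `|B z a w| <= 2 * `|w| + 4 * k * `|a| ^+ 2.
      by rewrite ge_max !BX.
    have : k * `|a| ^+ 2 <= k * `|a|.
      apply: ler_wpM2l => //; have a1 : `|a| <= 1 by lra.
      by rewrite expr2 ler_piMr.
    have := mulr_ge0 k0 aw0; have := normr_ge0 a.
    by rewrite /s; lra.
  have : s ^+ 2 <= ((2 + 4 * k) * (`|w| + `|a|)) ^+ 2.
    by rewrite ler_sqr ?nnegrE//; exact: le_trans s_aw.
  move=> /(ler_wpM2l k0).
  have : 0 <= k * (2 + 4 * k) ^+ 2 * (`|w| - `|a|) ^+ 2.
    by rewrite mulr_ge0 ?sqr_ge0// mulr_ge0 ?sqr_ge0.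
  rewrite -/k /C /k3; lra.
- have ds : `|e| + `|0 : A| + `|0 : X1| < r / 2 by rewrite !normr0 !addr0.
  apply/eqP; rewrite -normr_le0; apply: le_trans (BX _ _ _ ds) _.
  by rewrite !normr0 expr0n/= !mulr0 addr0.
- have [er ar _] := small _ _ _ ds; have [e'r a'r _] := small _ _ _ ds'.
  have [br Tb] := BP _ _ _ ds; have [b'r Tb'] := BP _ _ _ ds'.
  have s0 : `|a| + `|B e a w| <= 2 * r by lra.
  have s2 : `|a'| + `|B e a w| <= 2 * r by lra.
  have s3 : `|a'| + `|B e' a' w'| <= 2 * r by lra.
  apply: le_trans
    (fixed_point_lipschitz er ar br e'r a'r b'r s0 s2 s3 _ Tb Tb') _ => //.
  have dE := normr_ge0 (e - e'); have dA := normr_ge0 (a - a').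
  have dW := normr_ge0 (i (w - w')).
  have r2 : (2 * r) ^+ 2 <= 1 by rewrite expr_le1//; lra.
  have := ler_wpM2r dE r2; have := ler_wpM2r dA r_half; rewrite !mul1r => hA hE.
  have := ler_wpM2l k0 hA; have := ler_wpM2l k0 hE.
  have := mulr_ge0 k0 dW; have := mulr_ge0 k30 dW.
  have := mulr_ge0 k30 dE; have := mulr_ge0 k30 dA.
  by rewrite -/k /C; lra.
Qed.

End FixedPoint.

(** * The theorem *)

Theorem proposition2p9 (R : realType) (m n : nat)
  (B1 B2 X1 X2 : completeNormedModType R)
  (iX1B1 : {linear X1 -> B1}) (iB2B1 : {linear B2 -> B1})
  (iX2X1 : {linear X2 -> X1}) (iX2B2 : {linear X2 -> B2})
  (eX1B1 : embedding iX1B1) (eB2B1 : embedding iB2B1)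
  (eX2X1 : embedding iX2X1) (eX2B2 : embedding iX2B2)
  (ecomm : forall x : X2, iX1B1 (iX2X1 x) = iB2B1 (iX2B2 x))
  (ballX1_closed : closed (iX1B1 @` [set b : X1 | `|b| <= 1]))
  (S : 'rV[R]_m -> 'rV[R]_n -> X1 -> B1 -> B1)
  (N2 : 'rV[R]_m -> 'rV[R]_n -> X1 -> X2)
  (U : set ('rV[R]_m * 'rV[R]_n * X1))
  (U_nbhs : open_nbhs (0 : 'rV[R]_m * 'rV[R]_n * X1) U)
  (S_bounded : forall (e : 'rV[R]_m) (a : 'rV[R]_n) (b : X1),
     U (e, a, b) -> bounded_on_both iX1B1 (S e a b))
  (N2_continuous : continuous_B1 iX1B1 U N2)
  (N2_0 : forall e : 'rV[R]_m, U (e, 0, 0) -> N2 e 0 0 = 0)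
  (C0 delta0 : R) (delta0_gt0 : 0 < delta0)
  (N2_bound : forall (e : 'rV[R]_m) (a : 'rV[R]_n) (b : X1),
     `|e| + `|a| + `|b| < delta0 ->
     `|N2 e a b| <= C0 * (`|a| + `|b|) ^+ 2)
  (N2_dab : forall (e : 'rV[R]_m) (a : 'rV[R]_n) (b : X1),
     `|e| + `|a| + `|b| < delta0 ->
     (loclip normr (EFin \o inorm iX2B2) (fun a' => N2 e a' b) a +
      loclip (inorm iX1B1) (EFin \o inorm iX2B2)
        (fun b' => N2 e a b') b
      <= (C0 * (`|a| + `|b|))%:E)%E)
  (N2_de : forall (e : 'rV[R]_m) (a : 'rV[R]_n) (b : X1),
     `|e| + `|a| + `|b| < delta0 ->
     (loclip normr (EFin \o inorm iX2B2) (fun e' => N2 e' a b) e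
      <= (C0 * (`|a| + `|b|) ^+ 2)%:E)%E)
  (* Q e a b is written (Id - S(e,a,b))^-1 on paper *)
  (Q : 'rV[R]_m -> 'rV[R]_n -> X1 -> X2 -> X1)
  (V : set ('rV[R]_m * 'rV[R]_n * X1))
  (V_nbhs : open_nbhs (0 : 'rV[R]_m * 'rV[R]_n * X1) V)
  (Q_right_inverse : forall (e : 'rV[R]_m) (a : 'rV[R]_n) (b : X1),
     V (e, a, b) ->
     is_right_inverse iX2X1 iX1B1 (S e a b) (Q e a b))
  (Q_db : (ereal_sup
     [set loclip (inorm iX1B1)
            (opnorm (inorm iX2B2) (inorm iX1B1))
            (fun b' => Q v.1.1 v.1.2 b') v.2 | v in V] < +oo)%E)
  (Q_dea : (ereal_sup
     [set loclip normr (opnorm normr (inorm iX1B1))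
            (fun ea : 'rV[R]_m * 'rV[R]_n => Q ea.1 ea.2 v.2) v.1
       | v in V] < +oo)%E)
  (Q_X2X1 : (ereal_sup
     [set opnorm normr normr (Q v.1.1 v.1.2 v.2) | v in V] < +oo)%E)
  (Q_B2B1 : (ereal_sup
     [set opnorm (inorm iX2B2) (inorm iX1B1)
            (Q v.1.1 v.1.2 v.2) | v in V] < +oo)%E) :
  exists (r delta C : R) (B : 'rV[R]_m -> 'rV[R]_n -> X1 -> X1),
    [/\ 0 < r, 0 < delta,
        forall (e : 'rV[R]_m) (a : 'rV[R]_n) (w : X1),
          `|e| + `|a| + `|w| < delta ->
          [/\ `|B e a w| <= r /\ calT Q N2 e a (B e a w) w = B e a w,
              forall b, `|b| <= r -> calT Q N2 e a b w = b -> b = B e a w,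
              `|iX1B1 (B e a w)| <= C * (`|iX1B1 w| + `|a| ^+ 2),
              `|B e a w| <= C * (`|w| + `|a| ^+ 2) &
              (loclip normr (EFin \o inorm iX1B1) (fun e' => B e' a w) e
               <= (C * (`|w| ^+ 2 + `|a| ^+ 2))%:E)%E],
        forall e : 'rV[R]_m, `|e| < delta -> B e 0 0 = 0 &
        forall (e : 'rV[R]_m) (a : 'rV[R]_n) (w : X1)
            (e' : 'rV[R]_m) (a' : 'rV[R]_n) (w' : X1),
          `|e| + `|a| + `|w| < delta -> `|e'| + `|a'| + `|w'| < delta ->
          `|iX1B1 (B e a w - B e' a' w')|
            <= C * (`|e - e'| + `|a - a'| + `|iX1B1 (w - w')|)].
Proof.
have iB x y : iX1B1 (x - y) = iX1B1 x - iX1B1 y by rewrite linearB.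
have jB x y : iX2B2 (x - y) = iX2B2 x - iX2B2 y by rewrite linearB.
have inorm_i0 x : 0 <= inorm iX1B1 x by exact: normr_ge0.
have inorm_iZ t x : inorm iX1B1 (t *: x) = `|t| * inorm iX1B1 x.
  by rewrite /inorm linearZ normrZ.
have inorm_j0 x : 0 <= inorm iX2B2 x by exact: normr_ge0.
have norm_j w c : ((EFin \o inorm iX2B2) w <= c%:E)%E -> `|iX2B2 w| <= c * 1.
  by rewrite mulr1 /= lee_fin.
have evalB x (F G : X2 -> X1) : iX1B1 ((F - G) x) = iX1B1 (F x) - iX1B1 (G x).
  exact: iB.
have op_j x (F : X2 -> X1) c :
    (opnorm (inorm iX2B2) (inorm iX1B1) F <= c%:E)%E ->
    `|iX1B1 (F x)| <= c * inorm iX2B2 x by exact: opnorm_le (inorm_j0 x).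
have op_2 x (F : X2 -> X1) c : (opnorm normr (inorm iX1B1) F <= c%:E)%E ->
    `|iX1B1 (F x)| <= c * `|x| by exact: opnorm_le (normr_ge0 x).
have [d d0 dV] : exists2 d : R, 0 < d & forall e a b,
    `|e| < d -> `|a| < d -> `|b| < d -> V (e, a, b).
  have /nbhs_normP[d d0 dV] := open_nbhs_nbhs V_nbhs.
  exists d => // e a b ed ad bd; apply: dV.
  by rewrite /ball_ /= sub0r normrN !prod_normE /= !gt_max ed ad bd.
have [M1 M10 Q1] := ereal_sup_bounded Q_db.
have [M2 M20 Q2] := ereal_sup_bounded Q_dea.
have [M3 M30 Q3] := ereal_sup_bounded Q_X2X1.
have [M4 M40 Q4] := ereal_sup_bounded Q_B2B1.
pose K := `|C0| + M1 + M2 + M3 + M4.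
have C00 := normr_ge0 C0.
have K0 : 0 <= K by rewrite /K !addr_ge0.
have M1K : M1 <= K by rewrite /K; lra.
have M2K : M2 <= K by rewrite /K; lra.
have M3K : M3 <= K by rewrite /K; lra.
have M4K : M4 <= K by rewrite /K; lra.
have C0K u v : 0 <= u -> u <= v -> C0 * u <= K * v.
  move=> u0 uv; apply: (@le_trans _ _ (K * u)); last exact: ler_wpM2l.
  by apply: ler_wpM2r => //; have := ler_norm C0; rewrite /K; lra.
(* a sum of three norms below delta0 / 4 is below delta0 *)
pose rho := minr d (delta0 / 4).
pose box (e : 'rV[R]_m) (a : 'rV[R]_n) (b : X1) :=
  [&& `|e| < rho, `|a| < rho & `|b| < rho].
have rho0 : 0 < rho by rewrite lt_min d0 divr_gt0.
have boxV e a b : box e a b -> V (e, a, b).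
  rewrite /box !lt_min => /and3P[] /andP[? _] /andP[? _] /andP[? _].
  exact: dV.
have box_delta e a b : box e a b -> `|e| + `|a| + `|b| < delta0.
  by rewrite /box !lt_min => /and3P[] /andP[_ ?] /andP[_ ?] /andP[_ ?]; lra.
(* r < rho, and r (8 K^2 + 2) <= 1 gives both smallness conditions on r *)
pose r := minr (rho / 2) (8 * K ^+ 2 + 2)^-1.
have K20 := sqr_ge0 K.
have den0 : 0 < 8 * K ^+ 2 + 2 by lra.
have r0 : 0 < r by rewrite lt_min divr_gt0// invr_gt0.
have r_rho : r < rho.
  by apply: (@le_lt_trans _ _ (rho / 2)); [rewrite ge_min lexx|lra].
have rK : 8 * K ^+ 2 * r + 2 * r <= 1.
  by rewrite -mulrDl -ler_pdivlMl// mulr1 ge_min lexx orbT.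
have Kr0 : 0 <= 8 * K ^+ 2 * r by rewrite !mulr_ge0// ltW.
have [C [B [BP B0 Blip]]] :
  exists (C : R) (B : 'rV[R]_m -> 'rV[R]_n -> X1 -> X1),
  [/\ forall e a w, `|e| + `|a| + `|w| < r / 2 ->
        [/\ `|B e a w| <= r /\ calT Q N2 e a (B e a w) w = B e a w,
            forall b, `|b| <= r -> calT Q N2 e a b w = b -> b = B e a w,
            `|iX1B1 (B e a w)| <= C * (`|iX1B1 w| + `|a| ^+ 2),
            `|B e a w| <= C * (`|w| + `|a| ^+ 2) &
            (loclip normr (EFin \o inorm iX1B1) (fun e' => B e' a w) e
             <= (C * (`|w| ^+ 2 + `|a| ^+ 2))%:E)%E],
      forall e, `|e| < r / 2 -> B e 0 0 = 0 &
      forall e a w e' a' w',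
        `|e| + `|a| + `|w| < r / 2 -> `|e'| + `|a'| + `|w'| < r / 2 ->
        `|iX1B1 (B e a w - B e' a' w')|
          <= C * (`|e - e'| + `|a - a'| + `|iX1B1 (w - w')|)]; last first.
  by exists r, (r / 2), C, B; split => //; rewrite divr_gt0.
apply: (@fixed_point_map _ _ _ _ _ _ _ iX1B1 iX2B2 eX1B1.1 eX1B1.2 eX2B2.2
  ballX1_closed N2 Q K rho K0) => //; last 2 first; [by lra|by lra|..].
- move=> e a b /boxV /Q_right_inverse[Q_lin _] x y.
  have := Q_lin (-1) y x; rewrite !scaleN1r => QB.
  by rewrite addrC QB addrC.
- move=> e a b /boxV v x.
  have QM := Q3 _ (imageP _ v).
  apply: le_trans (opnorm_le (normr_ge0 x) QM) _.
  exact: ler_wpM2r.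
- move=> e a b /boxV v x.
  have QM := Q4 _ (imageP _ v).
  apply: le_trans (opnorm_le (inorm_j0 x) QM) _.
  exact: ler_wpM2r.
- move=> e a b b' v v' x.
  apply: le_trans (loclip_segment inorm_i0 inorm_iZ (evalB x) (inorm_j0 x)
    (op_j x)
    (f := fun b' => Q e a b') (x := b') (y := b) (L := M1) _) _.
  2: by apply: ler_wpM2r => //; exact: ler_wpM2r.
  move=> t t01; apply: (Q1 _); exists (e, a, b' + t *: (b - b')) => //.
  apply: boxV; case/and3P: v => er ar br; case/and3P: v' => _ _ b'r.
  by apply/and3P; split => //; exact: norm_segment_lt.
- move=> e a e' a' b v v' x.
  apply: le_trans (loclip_segment (@normr_ge0 _ _) (@normrZ _ _) (evalB x)
    (normr_ge0 x)
    (op_2 x)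
    (f := fun ea : 'rV[R]_m * 'rV[R]_n => Q ea.1 ea.2 b)
    (x := (e', a')) (y := (e, a)) (L := M2) _) _.
  + move=> t t01; apply: (Q2 _).
    exists (e' + t *: (e - e'), a' + t *: (a - a'), b) => //.
    apply: boxV; case/and3P: v => er ar br; case/and3P: v' => e'r a'r _.
    by apply/and3P; split => //; exact: norm_segment_lt.
    apply: ler_wpM2r => //; apply: le_trans (ler_wpM2r (normr_ge0 _) M2K) _.
  apply: ler_wpM2l => //.
  by rewrite prod_normE ge_max /= lerDl lerDr !normr_ge0.
- move=> e a b v; apply: le_trans (N2_bound _ _ _ (box_delta _ _ _ v)) _.
  by apply: C0K => //; exact: sqr_ge0.
- move=> e e' a b v v'.
  apply: le_trans (loclip_segment (@normr_ge0 _ _) (@normrZ _ _) jB ler01 norm_j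
    (f := fun e => N2 e a b) (x := e') (y := e)
    (L := C0 * (`|a| + `|b|) ^+ 2) _) _.
  + move=> t t01; apply: N2_de; apply: box_delta.
    case/and3P: v => er ar br; case/and3P: v' => e'r _ _.
    by apply/and3P; split => //; exact: norm_segment_lt.
  by rewrite mulr1; apply: ler_wpM2r => //; apply: C0K => //; exact: sqr_ge0.
- move=> e a a' b s v v' s1 s2.
  apply: le_trans (loclip_segment (@normr_ge0 _ _) (@normrZ _ _) jB ler01 norm_j
    (f := fun a => N2 e a b) (x := a') (y := a) (L := K * s) _) _.
  2: by rewrite mulr1.
  move=> t t01.
  have v'' : box e (a' + t *: (a - a')) b.
    case/and3P: v => er ar br; case/and3P: v' => _ a'r _.
    by apply/and3P; split => //; exact: norm_segment_lt.
  apply: le_trans (leeDl _ (loclip_ge0 _ _ _ _)) _.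
  apply: le_trans (N2_dab _ _ _ (box_delta _ _ _ v'')) _.
  rewrite lee_fin; apply: C0K; first exact: addr_ge0.
  by rewrite -lerBrDr; apply: norm_segment_le => //; rewrite lerBrDr.
- move=> e a b b' s v v' s1 s2.
  apply: le_trans (loclip_segment inorm_i0 inorm_iZ jB ler01 norm_j
    (f := fun b => N2 e a b) (x := b') (y := b) (L := K * s) _) _.
  2: by rewrite mulr1.
  move=> t t01.
  have v'' : box e a (b' + t *: (b - b')).
    case/and3P: v => er ar br; case/and3P: v' => _ _ b'r.
    by apply/and3P; split => //; exact: norm_segment_lt.
  apply: le_trans (leeDr _ (loclip_ge0 _ _ _ _)) _.
  apply: le_trans (N2_dab _ _ _ (box_delta _ _ _ v'')) _.
  rewrite lee_fin; apply: C0K; first exact: addr_ge0.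
  by rewrite -lerBrDl; apply: norm_segment_le => //; rewrite lerBrDl.
Qed.
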